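(* There is an absolute constant $c>0$ such that the following holds. Let $p \geq 2$ and $d \geq 1$ be an integer. Then for every $n$-point subset $\mathcal{C} \subset \ell_p^d$ (equipped with the $\ell_p$ metric) and every $\Delta>0$, there exists a $(\beta,\Delta)$-Lipschitz decomposition of $\mathcal{C}$ with $\beta = c\, p^4\sqrt{\min\{\log n, d\}}$.
   Context: Let $(\mathcal{M},d_\mathcal{M})$ be a metric space. A distribution $\mathcal{D}$ over partitions of $\mathcal{M}$ is a $(\beta,\Delta)$-Lipschitz decomposition if (i) for every partition $P$ in the support of $\mathcal{D}$, every cluster $C\in P$ has $\operatorname{diam}(C)=\sup_{x,y\in C} d_\mathcal{M}(x,y)\le \Delta$; and (ii) for every $x,y\in\mathcal{M}$, $\Pr_{P\sim\mathcal{D}}[P(x)\ne P(y)]\le \beta\, d_\mathcal{M}(x,y)/\Delta$, where $P(z)$ is the cluster of $P$ containing $z$. The space $\ell_p^d$ is $\mathbb{R}^d$ with the norm $\|x\|_p=(\sum_i |x_i|^p)^{1/p}$. *)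

(* Defs.v *)
From HB Require Import structures.
From mathcomp Require Import all_boot all_order all_algebra.
From mathcomp Require Import all_classical all_reals all_analysis.
From mathcomp Require Import Rstruct.
From Stdlib Require Import Rdefinitions.
Set Implicit Arguments. Unset Strict Implicit. Unset Printing Implicit Defensive.
Import Order.TTheory GRing.Theory Num.Theory.
Local Open Scope ring_scope.

Definition lp_dist (p : R) (d : nat) (u v : 'I_d -> R) : R :=
  (\sum_(k < d) `|u k - v k| `^ p) `^ p^-1.

Definition lipschitz_decomposition (n : nat) (dist : 'I_n -> 'I_n -> R)
    (beta Delta : R) (mu : {ffun {set {set 'I_n}} -> R}) : Prop :=
  (forall P, 0 <= mu P) /\
  (\sum_(P : {set {set 'I_n}}) mu P = 1) /\
  (forall P, 0 < mu P ->
     finset.partition P [set: 'I_n] /\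
     (forall B, B \in P -> forall i j, i \in B -> j \in B -> dist i j <= Delta)) /\
  (forall i j, \sum_(P : {set {set 'I_n}} | finset.pblock P i != finset.pblock P j) mu P <= beta * dist i j / Delta).

(* Main.v *)
(** The Euclidean case comes from soft random partitions: attach to each point a
    probability distribution (a finite substitute for the Gaussian of standard
    deviation [1 / a] centred at the point), and couple all of them so that two
    points receive different labels with probability at most twice their total
    variation distance, which is [O(a |x - y|)]. With [a] of order
    [sqrt d / Delta] the distributions can be truncated to balls of radius
    [Delta / 2]; with [a] of order [sqrt (ln n) / Delta] far apart points have
    exponentially small affinity and a union bound over pairs suffices.

    The exponent is then raised through the Mazur map [t |-> sg t |t| ^ r] from
    [l_(r q)] to [l_q]. On a ball of radius [2 Delta] of [l_(r q)] it is
    Lipschitz with an inverse that is Hoelder of exponent [1 / r], so a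
    decomposition of scale [2 Delta] can be refined to scale [Delta] by pulling
    back, in each cluster, a decomposition of [l_q]; the losses form a geometric
    series. Doubling the exponent multiplies [beta] by [16 = 2 ^ 4], whence
    [p ^ 4]. *)
Require Import Defs.
From HB Require Import structures.
From mathcomp Require Import all_boot all_order all_algebra.
From mathcomp Require Import all_classical all_reals all_analysis.
From mathcomp Require Import Rstruct ring lra.
From Stdlib Require Import Rdefinitions.
Set Implicit Arguments. Unset Strict Implicit. Unset Printing Implicit Defensive.
Import Order.TTheory GRing.Theory Num.Theory.
Local Open Scope ring_scope.

(** * Layer-cake weights and the coupling of finitely many distributions *)

Lemma sum_delta (R : realFieldType) (T : finType) (P : pred T) (A : T) (m : R) :
  \sum_(S | P S) (if S == A then m else 0) = if P A then m else 0.
Proof.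
rewrite -big_mkcondr; case: ifPn => PA.
  apply: (@big_pred1 _ _ _ _ A) => S /=; rewrite andbC.
  by case: eqP => // ->.
by rewrite big1// => S /andP[PS /eqP SA]; rewrite SA (negPf PA) in PS.
Qed.

(** Induction on the size of the support, peeling off the least positive value. The weights sit on a
    chain of superlevel sets, and a set of the chain separates [i] from [j] exactly when its level
    lies between [g i] and [g j]. *)
Lemma layer_cake (R : realFieldType) (I : finType) (g : I -> R) :
  (forall i, 0 <= g i) ->
  exists w : {set I} -> R, [/\ forall S, 0 <= w S,
    forall i, \sum_(S : {set I} | i \in S) w S = g i &
    forall i j, \sum_(S : {set I} | (i \in S) != (j \in S)) w S = `|g i - g j|].
Proof.
have [N] := ubnP #|[pred i | g i != 0]|.
elim: N g => // N IH g; rewrite ltnS => leN g0.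
have [g00|/existsP[i1 gi1]] := boolP [forall i, g i == 0].
  exists (fun=> 0); split => // [i|i j]; rewrite big1//.
    by rewrite (eqP (forallP g00 i)).
  by rewrite !(eqP (forallP g00 _)) subrr normr0.
have [i0 gi0 min0] : exists2 i0, g i0 != 0 & forall i, g i != 0 -> g i0 <= g i.
  case: (Order.TotalTheory.arg_minP (P := fun i => g i != 0) g gi1) => i0 h1 h2.
  by exists i0 => // i /h2.
pose A : {set I} := finset (fun i => g i != 0).
pose g' i := if i \in A then g i - g i0 else 0.
have inA i : (i \in A) = (g i != 0) by rewrite finset.inE.
have [|i|w [w0 w1 w2]] := IH g'.
- apply: leq_trans leN; apply: proper_card; apply/properP; split.
    apply/fintype.subsetP => i; rewrite !inE /g' inA; by case: ifP => // _; rewrite eqxx.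
  by exists i0; rewrite !inE // /g' inA gi0 subrr eqxx.
- by rewrite /g' inA; case: ifP => // /min0; rewrite subr_ge0.
exists (fun S => w S + if S == A then g i0 else 0); split.
- by move=> S; rewrite addr_ge0//; case: ifP.
- move=> i; rewrite big_split/= w1 sum_delta /g'; case: ifP => // [_|].
    by rewrite subrK.
  by rewrite inA addr0 => /negbFE/eqP.
- move=> i j; rewrite big_split/= w2 sum_delta /g' !inA.
  have p0 := g0 i0.
  case: (eqVneq (g i) 0) => [gi|gi]; case: (eqVneq (g j) 0) => [gj|gj] //=.
  + by rewrite gi gj addr0.
  + have mj := min0 _ gj; rewrite gi !sub0r !normrN !ger0_norm ?subr_ge0 ?subrK//.
  + have mj := min0 _ gi; rewrite gj !subr0 !ger0_norm ?subr_ge0 ?subrK//.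
  + by rewrite addr0; congr (`| _ |); ring.
Qed.

(* Repeatedly drawing a layer [(z, S)] and giving the label [z] to the still
   unlabelled points of [S] terminates after finitely many effective steps, so
   the infinite sampling process is replaced by recursion on the set [U] of
   unlabelled points, each step being conditioned on [S] meeting [U]. *)
Lemma consistent_rounding_on (R : realFieldType) (I Z : finType) (z0 : Z)
    (h : I -> Z -> R) (m : R) :
  0 < m -> (forall i z, 0 <= h i z) -> (forall i, m <= \sum_z h i z) ->
  forall U : {set I}, exists nu : {ffun I -> Z} -> R,
    [/\ forall f, 0 <= nu f, \sum_f nu f = 1,
      forall i z, i \in U ->
        \sum_(f : {ffun I -> Z} | f i == z) nu f = h i z / \sum_z h i z &
      forall i j, i \in U -> j \in U ->
        \sum_(f : {ffun I -> Z} | f i != f j) nu f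
          <= (\sum_z `|h i z - h j z|) / m].
Proof.
move=> m0 h0 hm U.
have [w wP] := choice (fun z => @layer_cake R I (h^~ z) (fun i => h0 i z)).
have w0 z S : 0 <= w z S by have [] := wP z.
have w1 z i : \sum_(S : {set I} | i \in S) w z S = h i z by have [] := wP z.
have w2 z i j : \sum_(S : {set I} | (i \in S) != (j \in S)) w z S = `|h i z - h j z|.
  by have [] := wP z.
have [N] := ubnP #|U|.
elim: N U => // N IH U; rewrite ltnS => leN.
have [->|U0] := eqVneq U finset.set0.
  exists (fun f => if f == [ffun=> z0] then 1 else 0); split.
  - by move=> f; case: ifP.
  - exact: sum_delta.
  - by move=> i z; rewrite finset.inE.
  - by move=> i j; rewrite finset.inE.
(* Guarding the induction hypothesis by [V \proper U] makes it total in [V], so that [choice] yields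
   one function [nu]. *)
pose Q (V : {set I}) (nu : {ffun I -> Z} -> R) := V \proper U -> [/\ forall f, 0 <= nu f,
  \sum_f nu f = 1,
      forall i z, i \in V ->
        \sum_(f : {ffun I -> Z} | f i == z) nu f = h i z / \sum_z h i z &
      forall i j, i \in V -> j \in V ->
        \sum_(f : {ffun I -> Z} | f i != f j) nu f
          <= (\sum_z `|h i z - h j z|) / m].
have QE V : exists nu, Q V nu.
  have [VU|nVU] := boolP (V \proper U).
    have [|nu h1] := IH V; first by rewrite (leq_trans _ leN)// proper_card.
    by exists nu.
  by exists (fun=> 0) => VU; rewrite VU in nVU.
have [nu nuP] := choice QE.
pose A (t : Z * {set I}) := finset.setI t.2 U != finset.set0.
pose W := \sum_(t | A t) w t.1 t.2.
pose V (t : Z * {set I}) := finset.setD U t.2.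
have VU t : A t -> V t \proper U.
  move=> /finset.set0Pn[i]; rewrite finset.inE => /andP[it iU].
  apply/properP; split; first exact: finset.subsetDl.
  by exists i => //; rewrite finset.inE it.
have AU i (t : Z * {set I}) : i \in U -> i \in t.2 -> A t.
  by move=> iU it; apply/finset.set0Pn; exists i; rewrite finset.inE it.
have sumA i (F : Z -> R) : i \in U ->
    \sum_(t : Z * {set I} | A t && (i \in t.2)) w t.1 t.2 * F t.1 = \sum_z h i z * F z.
  move=> iU; transitivity (\sum_(t : Z * {set I} | i \in t.2) w t.1 t.2 * F t.1).
    apply: eq_bigl => t; case it: (i \in t.2); rewrite ?andbF// andbT.
    exact: AU it.
  rewrite -(pair_big_dep xpredT (fun z (S : {set I}) => i \in S)
    (fun z S => w z S * F z)) /=.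
  by apply: eq_bigr => z _; rewrite -mulr_suml w1.
have sumA1 i : i \in U ->
    \sum_(t : Z * {set I} | A t && (i \in t.2)) w t.1 t.2 = \sum_z h i z.
  move=> iU; rewrite (eq_bigr (fun t => w t.1 t.2 * 1)); last by move=> *; rewrite mulr1.
  by rewrite (sumA _ (fun=> 1))//; apply: eq_bigr => z _; rewrite mulr1.
have sumAC i : i \in U ->
    \sum_(t : Z * {set I} | A t && (i \notin t.2)) w t.1 t.2 = W - \sum_z h i z.
  by move=> iU; rewrite /W [in RHS](bigID (fun t : Z * {set I} => i \in t.2))/= sumA1// addrAC subrr add0r.
have W0 : 0 < W.
  have /finset.set0Pn[i iU] := U0.
  have := sumAC i iU; have : 0 <= \sum_(t : Z * {set I} | A t && (i \notin t.2)) w t.1 t.2.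
    by apply: sumr_ge0.
  have := hm i; lra.
pose glue (t : Z * {set I}) (f : {ffun I -> Z}) :=
  [ffun i => if i \in t.2 then t.1 else f i].
(* A layer meeting [U] is drawn with probability proportional to its weight; the points outside it
   are labelled by the solution for the smaller set [V t]. *)
pose nu' f := W^-1 * \sum_(t | A t) w t.1 t.2 * \sum_(f' | glue t f' == f) nu (V t) f'.
have nu'E (P : pred {ffun I -> Z}) : \sum_(f | P f) nu' f =
    W^-1 * \sum_(t | A t) w t.1 t.2 * \sum_(f | P (glue t f)) nu (V t) f.
  rewrite -mulr_sumr exchange_big/=; congr (_ * _); apply: eq_bigr => t At.
  rewrite -mulr_sumr; congr (_ * _).
  rewrite [RHS](partition_big (glue t) P)//=; apply: eq_bigr => f Pf.
  by apply: eq_bigl => f'; case: eqP => [->|]; rewrite ?Pf ?andbF.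
exists nu'; split.
- move=> f; apply: mulr_ge0; first by rewrite invr_ge0 ltW.
  apply: sumr_ge0 => t At.
  by rewrite mulr_ge0// sumr_ge0// => f' _; have [] := nuP _ (VU _ At).
- rewrite nu'E (eq_bigr (fun t => w t.1 t.2)).
    by rewrite -/W mulVf// gt_eqF.
  by move=> t At; have [_ -> _ _] := nuP _ (VU _ At); rewrite mulr1.
(* With [M] the total mass at [i], immediate labelling contributes [h i z] and the layers missing
   [i] contribute [(W - M) * h i z / M]; the sum is [W * h i z / M]. *)
- move=> i z iU; have Mi : 0 < \sum_z h i z := lt_le_trans m0 (hm i).
  rewrite nu'E (bigID (fun t : Z * {set I} => i \in t.2))/=.
  rewrite (eq_bigr (fun t => w t.1 t.2 * (if t.1 == z then 1 else 0))); last first.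
    move=> t /andP[At it]; congr (_ * _).
    case: eqP => tz.
      have [_ <- _ _] := nuP _ (VU _ At); apply: eq_bigl => f.
      by rewrite ffunE it tz eqxx.
    by rewrite big1// => f; rewrite ffunE it => /eqP.
  rewrite (sumA i (fun z' => if z' == z then 1 else 0))//.
  rewrite [X in _ * (_ + X)](eq_bigr (fun t => w t.1 t.2 * (h i z / \sum_z h i z))); last first.
    move=> t /andP[At it]; congr (_ * _).
    have iV : i \in V t by rewrite finset.inE it.
    have [_ _ <- // _] := nuP _ (VU _ At); apply: eq_bigl => f.
    by rewrite ffunE (negPf it).
  rewrite -mulr_suml sumAC// (eq_bigr (fun z' => if z' == z then h i z else 0)).
    rewrite sum_delta; field.
    by rewrite !gt_eqF.
  by move=> z' _; case: eqP => [->|_]; rewrite ?mulr1 ?mulr0.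
- move=> i j iU jU; set D := \sum_z _.
  have D0 : 0 <= D by apply: sumr_ge0.
  rewrite nu'E mulrC ler_pdivrMr//.
  (* A layer containing exactly one of the points may separate them; a layer missing both leaves
     them to the induction hypothesis. The former weigh [D], those missing [i] at most [W - m], so
     the bound [D / m] reproduces itself. *)
  have le1 t : A t -> w t.1 t.2 * \sum_(f : {ffun I -> Z} | glue t f i != glue t f j) nu (V t) f
     <= (if (i \in t.2) != (j \in t.2) then w t.1 t.2 else 0) +
        (if i \notin t.2 then w t.1 t.2 else 0) * (D / m).
    move=> At; have [n0 n1 n2 n3] := nuP _ (VU _ At).
    have wt0 := w0 t.1 t.2; have Dm0 : 0 <= D / m by rewrite divr_ge0// ltW.
    rewrite (eq_bigl (fun f : {ffun I -> Z} => (if i \in t.2 then t.1 else f i) !=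
      (if j \in t.2 then t.1 else f j))); last by move=> f; rewrite !ffunE.
    have sum_le1 (P : pred {ffun I -> Z}) : \sum_(f | P f) nu (V t) f <= 1.
      by rewrite -n1 [leRHS](bigID P)/= lerDl sumr_ge0.
    case it: (i \in t.2); case jt: (j \in t.2) => /=.
    + by rewrite big1 ?mulr0 ?mul0r ?addr0// => f; rewrite eqxx.
    + by rewrite mul0r addr0 ler_piMr.
    + by rewrite (le_trans (ler_piMr wt0 (sum_le1 _)))// lerDl mulr_ge0.
    + by rewrite add0r ler_wpM2l// n3// finset.inE ?it ?jt.
  apply: le_trans (ler_sum _ le1) _.
  rewrite big_split/= -mulr_suml -!big_mkcondr/= sumAC//.
  have -> : \sum_(t : Z * {set I} | A t && ((i \in t.2) != (j \in t.2))) w t.1 t.2 = D.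
    transitivity (\sum_(t : Z * {set I} | (i \in t.2) != (j \in t.2)) w t.1 t.2).
      apply: eq_bigl => t; case: eqVneq; rewrite ?andbF// andbT.
      case it: (i \in t.2); first by move=> _; exact: AU it.
      by case jt: (j \in t.2) => // _; exact: AU jt.
    rewrite -(pair_big_dep xpredT (fun z (S : {set I}) => (i \in S) != (j \in S)) w)/=.
    by apply: eq_bigr => z _; rewrite w2.
  have -> : D / m * W = D + (W - m) * (D / m) by field; rewrite gt_eqF.
  by rewrite lerD2l ler_wpM2r ?divr_ge0 ?(ltW m0)// lerD2l lerN2.
Qed.

(** * Random labellings as random partitions, and refinement *)

Lemma eq_pblock_preim (T : finType) (rT : eqType) (f : T -> rT) (x y : T) :
  (finset.pblock (preim_partition f [set: T]) x ==
   finset.pblock (preim_partition f [set: T]) y) = (f x == f y).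
Proof.
have /and3P[/eqP cP tP _] := preim_partitionP f [set: T].
rewrite finset.eq_pblock ?cP ?finset.inE// pblock_equivalence_partition ?finset.inE//.
by split=> //= /eqP->.
Qed.

(** Clusters are the label classes of a random labelling. Distinct outcomes may induce the same
    partition, so [mu] is the push-forward of [w]. *)
Lemma lipschitz_decomposition_of_labels (n : nat) (dist : 'I_n -> 'I_n -> R)
    (beta Delta : R) (Omega : finType) (T : eqType) (w : Omega -> R)
    (lab : Omega -> 'I_n -> T) :
  (forall o, 0 <= w o) -> \sum_o w o = 1 ->
  (forall o, 0 < w o -> forall i j, lab o i = lab o j -> dist i j <= Delta) ->
  (forall i j, \sum_(o | lab o i != lab o j) w o <= beta * dist i j / Delta) ->
  exists mu, lipschitz_decomposition dist beta Delta mu.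
Proof.
move=> w0 w1 wd wc.
pose part o := preim_partition (lab o) [set: 'I_n].
pose mu : {ffun {set {set 'I_n}} -> R} := [ffun P => \sum_(o | part o == P) w o].
have muE (Q : pred {set {set 'I_n}}) : \sum_(P | Q P) mu P = \sum_(o | Q (part o)) w o.
  rewrite [RHS](partition_big part Q)//; apply: eq_bigr => P QP.
  by rewrite ffunE; apply: eq_bigl => o; case: eqP => [->|]; rewrite ?QP ?andbF.
exists mu; split; [|split; [|split]].
- by move=> P; rewrite ffunE sumr_ge0.
- by rewrite muE.
- move=> P; rewrite ffunE => mP.
  have [t /andP[/eqP oP w_gt0]] : exists x, (part x == P) && (0 < w x).
    apply/existsP; apply: contraLR mP => /existsPn no; rewrite -leNgt.
    apply: sumr_le0 => o oP; rewrite leNgt; by have := no o; rewrite oP.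
  rewrite -oP; split; first exact: preim_partitionP.
  have /and3P[_ tP _] := preim_partitionP (lab t) [set: 'I_n].
  move=> B BP i j iB jB; apply: (wd t) => //; apply/eqP.
  by rewrite -eq_pblock_preim !(def_pblock tP BP).
- move=> i j; rewrite muE; apply: le_trans (wc i j).
  by under eq_bigl => o do rewrite eq_pblock_preim.
Qed.

Lemma sum_prod_ffun (K : comNzRingType) (I J : finType) (nu g : I -> J -> K) :
  \sum_(F : {ffun I -> J}) (\prod_i nu i (F i)) * \prod_i g i (F i) =
  \prod_i \sum_j nu i j * g i j.
Proof. by rewrite bigA_distr_bigA; apply: eq_bigr => F _; rewrite big_split. Qed.

Lemma sum_prod_marginal (K : comNzRingType) (I J : finType) (nu : I -> J -> K)
    (i0 : I) (Q : pred J) : (forall i, \sum_j nu i j = 1) ->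
  \sum_(F : {ffun I -> J} | Q (F i0)) \prod_i nu i (F i) = \sum_(j | Q j) nu i0 j.
Proof.
move=> nu1; pose g i j : K := if (i == i0) && ~~ Q j then 0 else 1.
transitivity (\sum_(F : {ffun I -> J}) (\prod_i nu i (F i)) * \prod_i g i (F i)).
  rewrite big_mkcond; apply: eq_bigr => F _; rewrite [X in _ * X](bigD1 i0)//=.
  rewrite [X in _ * (_ * X)]big1; last by move=> i /negPf ne; rewrite /g ne.
  by rewrite /g eqxx /=; case: (Q _); rewrite ?mulr1// ?mul0r mulr0.
rewrite sum_prod_ffun (bigD1 i0)//= [X in _ * X]big1; last first.
  move=> i /negPf ne; rewrite -[RHS](nu1 i); apply: eq_bigr => j _.
  by rewrite /g ne mulr1.
rewrite mulr1 [RHS]big_mkcond; apply: eq_bigr => j _.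
by rewrite /g eqxx /=; case: (Q _); rewrite ?mulr1 ?mulr0.
Qed.

(** A fine partition is drawn independently for every set [B], and a point is labelled by its coarse
    cluster together with its fine cluster there. Coarse clusters in the support have diameter at
    most [Delta'], so [nu B] only has to be good for such [B]; the two separation probabilities add
    up. *)
Lemma lipschitz_decomposition_refine (n : nat) (dist : 'I_n -> 'I_n -> R)
    (beta beta' gamma Delta Delta' : R) (mu : {ffun {set {set 'I_n}} -> R}) :
  0 < Delta -> 0 < Delta' -> lipschitz_decomposition dist beta Delta' mu ->
  (forall B : {set 'I_n}, exists nu : {ffun {set {set 'I_n}} -> R},
    [/\ forall P, 0 <= nu P, \sum_P nu P = 1 &
     (forall i j, i \in B -> j \in B -> dist i j <= Delta') ->
     (forall P, 0 < nu P -> forall i j, i \in B -> j \in B ->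
        finset.pblock P i = finset.pblock P j -> dist i j <= Delta) /\
     (forall i j, i \in B -> j \in B ->
        \sum_(P | finset.pblock P i != finset.pblock P j) nu P
          <= gamma * dist i j / Delta)]) ->
  (forall i j, 0 <= dist i j) -> 0 <= gamma ->
  beta * (Delta / Delta') + gamma <= beta' ->
  exists mu', lipschitz_decomposition dist beta' Delta mu'.
Proof.
move=> D0 D'0 [mu0 [mu1 [muS muC]]] /choice[nu nuP] dist0 gamma0 beta'_ge.
have g0 i j : 0 <= gamma * dist i j / Delta by rewrite divr_ge0 ?mulr_ge0// ltW.
have nu0 B P : 0 <= nu B P by have [] := nuP B.
have nu1 B : \sum_P nu B P = 1 by have [] := nuP B.
pose w (t : {set {set 'I_n}} * {ffun {set 'I_n} -> {set {set 'I_n}}}) :=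
  mu t.1 * \prod_B nu B (t.2 B).
pose lab (t : {set {set 'I_n}} * {ffun {set 'I_n} -> {set {set 'I_n}}}) i :=
  (finset.pblock t.1 i, finset.pblock (t.2 (finset.pblock t.1 i)) i).
have w0 t : 0 <= w t by rewrite mulr_ge0// prodr_ge0.
have inB P i : 0 < mu P -> i \in finset.pblock P i.
  by move=> /muS[/and3P[/eqP cP _ _] _]; rewrite finset.mem_pblock cP finset.inE.
have BP P i : 0 < mu P -> finset.pblock P i \in P.
  by move=> /muS[/and3P[/eqP cP _ _] _]; rewrite finset.pblock_mem// cP finset.inE.
apply: (@lipschitz_decomposition_of_labels _ _ _ _ _ _ w lab) => //.
- rewrite -(pair_bigA _ (fun P (F : {ffun {set 'I_n} -> {set {set 'I_n}}}) =>
    mu P * \prod_B nu B (F B)))/= -[RHS]mu1.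
  apply: eq_bigr => P _; rewrite -mulr_sumr.
  rewrite (sum_prod_marginal (nu := fun B => nu B) finset.set0 xpredT)//.
  by rewrite nu1 mulr1.
- move=> [P F]; rewrite /w /lab /= => wt i j [eqB].
  have mP : 0 < mu P.
    by rewrite lt_neqAle mu0 andbT; apply: contraTneq wt => <-; rewrite mul0r ltxx.
  have nB : 0 < nu (finset.pblock P i) (F (finset.pblock P i)).
    rewrite lt_neqAle nu0 andbT; apply: contraTneq wt => eq0.
    by rewrite (bigD1 (finset.pblock P i))//= -eq0 mul0r mulr0 ltxx.
  rewrite -eqB; have [_ _ /(_ _)[|dP _]] := nuP (finset.pblock P i).
    by have [_] := muS _ mP; apply; exact: BP.
  by apply: (dP _ nB); rewrite ?inB// eqB inB.
- move=> i j.
  pose q P (F : {ffun {set 'I_n} -> {set {set 'I_n}}}) := lab (P, F) i != lab (P, F) j.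
  rewrite -(pair_big_dep xpredT q (fun P (F : {ffun {set 'I_n} -> {set {set 'I_n}}}) =>
    mu P * \prod_B nu B (F B)))/=.
  have le1 P : \sum_(F | q P F) mu P * \prod_B nu B (F B) <=
      (if finset.pblock P i != finset.pblock P j then mu P else 0) +
      mu P * (gamma * dist i j / Delta).
    rewrite -mulr_sumr; have := mu0 P; rewrite le_eqVlt => /orP[/eqP<-|mP].
      by rewrite !mul0r; case: ifP; rewrite addr0.
    under eq_bigl => F do rewrite /q /lab /= xpair_eqE.
    case: eqP => [eqB|_] /=.
      rewrite add0r ler_wpM2l// -eqB.
      rewrite (sum_prod_marginal (nu := fun B => nu B) (finset.pblock P i)
        (fun P' => finset.pblock P' i != finset.pblock P' j))//.
      have [_ _ /(_ _)[|_]] := nuP (finset.pblock P i).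
        by have [_] := muS _ mP; apply; exact: BP.
      by apply; rewrite ?inB// eqB inB.
    rewrite (sum_prod_marginal (nu := fun B => nu B) finset.set0 xpredT)// nu1 mulr1.
    by rewrite lerDl mulr_ge0.
  apply: le_trans (ler_sum _ (fun P _ => le1 P)) _.
  rewrite big_split/= -mulr_suml mu1 mul1r -big_mkcond/=.
  apply: (@le_trans _ _ ((beta * (Delta / Delta') + gamma) * (dist i j / Delta))).
    have -> : (beta * (Delta / Delta') + gamma) * (dist i j / Delta)
      = beta * dist i j / Delta' + gamma * dist i j / Delta.
      by field; rewrite !gt_eqF.
    by rewrite lerD2r muC.
  by rewrite -[leRHS]mulrA ler_wpM2r// divr_ge0// ltW.
Qed.

(** * Affinity and variance for products of independent variables *)

Lemma sqr_sumM_le (K : realFieldType) (I : finType) (s t : I -> K) :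
  (\sum_i s i * t i) ^+ 2 <= (\sum_i s i ^+ 2) * \sum_i t i ^+ 2.
Proof.
set A := \sum_i s i ^+ 2; set B := \sum_i t i ^+ 2; set C := \sum_i _.
have B0 : 0 <= B by apply: sumr_ge0 => i _; exact: sqr_ge0.
have [B00|Bn0] := eqVneq B 0.
  have t0 i : t i = 0.
    move/eqP: B00; rewrite psumr_eq0 => [/allP/(_ i (mem_index_enum i))|j _].
      by rewrite sqrf_eq0 => /eqP.
    exact: sqr_ge0.
  rewrite /C big1 ?expr0n/=; last by move=> i _; rewrite t0 mulr0.
  by rewrite B00 mulr0.
have : 0 <= \sum_i (B * s i - C * t i) ^+ 2.
  by apply: sumr_ge0 => i _; exact: sqr_ge0.
have -> : \sum_i (B * s i - C * t i) ^+ 2 = B * (A * B - C ^+ 2).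
  rewrite (eq_bigr (fun i => B ^+ 2 * s i ^+ 2 - 2 * B * C * (s i * t i) +
    C ^+ 2 * t i ^+ 2)); last by move=> i _; ring.
  rewrite big_split big_split/= sumrN -!mulr_sumr -/A -/B -/C; ring.
by rewrite pmulr_rge0 ?subr_ge0// lt_neqAle eq_sym Bn0.
Qed.

Lemma prod_ge_1sub_sum (K : realFieldType) (I : finType) (x : I -> K) :
  (forall i, 0 <= x i <= 1) -> 1 - \sum_i (1 - x i) <= \prod_i x i.
Proof.
move=> x01; suff : 0 <= \prod_i x i <= 1 /\ 1 - \sum_i (1 - x i) <= \prod_i x i by case.
elim/big_rec2: _ => [|i p q _ [/andP[q0 q1] h]]; first by rewrite subr0 ler01 !lexx.
have /andP[x0 x1] := x01 i; split; last by nra.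
by rewrite mulr_ge0// mulr_ile1.
Qed.

Lemma prod_le_expR (K : realType) (I : finType) (x : I -> K) :
  (forall i, 0 <= x i) -> \prod_i x i <= expR (- \sum_i (1 - x i)).
Proof.
move=> x0; rewrite -sumrN expR_sum; apply: ler_prod => i _.
rewrite x0 /=; apply: le_trans (expR_ge1Dx _); lra.
Qed.

(** Cross terms vanish because the variables are independent and centred, so variances add. *)
Lemma sum_prod_variance (K : comNzRingType) (C J : finType) (nu u : C -> J -> K)
    (A : pred C) :
  (forall c, \sum_j nu c j = 1) -> (forall c, \sum_j nu c j * u c j = 0) ->
  \sum_(F : {ffun C -> J}) (\prod_c nu c (F c)) * (\sum_(c | A c) u c (F c)) ^+ 2 =
  \sum_(c | A c) \sum_j nu c j * u c j ^+ 2.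
Proof.
move=> nu1 u0.
have E (c c' : C) : \sum_(F : {ffun C -> J}) (\prod_c nu c (F c)) * (u c (F c) * u c' (F c')) =
    if c' == c then \sum_j nu c j * u c j ^+ 2 else 0.
  pose g i j := if i == c then (if c' == c then u c j ^+ 2 else u c j)
                else if i == c' then u c' j else 1.
  transitivity (\sum_(F : {ffun C -> J}) (\prod_c nu c (F c)) * \prod_c g c (F c)).
    apply: eq_bigr => F _; congr (_ * _); rewrite (bigD1 c)//= {1}/g eqxx.
    case: (eqVneq c' c) => [cc'|cc'].
      by rewrite big1 ?mulr1 ?expr2 ?cc'// => i /negPf ic; rewrite /g cc' ic.
    rewrite (bigD1 c')//= /g eqxx (negPf cc') big1 ?mulr1// => i /andP[/negPf ic /negPf ic'].
    by rewrite ic ic'.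
  rewrite sum_prod_ffun (bigD1 c)//= /g eqxx; case: (eqVneq c' c) => [cc'|_].
    rewrite [X in _ * X]big1 ?mulr1// => i /negPf ic; rewrite cc' ic -[RHS](nu1 i).
    by apply: eq_bigr => j _; rewrite mulr1.
  by rewrite u0 mul0r.
rewrite (eq_bigr (fun F : {ffun C -> J} => \sum_(c | A c) \sum_(c' | A c')
   (\prod_c nu c (F c)) * (u c (F c) * u c' (F c')))); last first.
  move=> F _; rewrite expr2 mulr_suml mulr_sumr; apply: eq_bigr => c _.
  by rewrite !mulr_sumr.
rewrite exchange_big/=; apply: eq_bigr => c Ac.
rewrite exchange_big/= (eq_bigr (fun c' => if c' == c then \sum_j nu c j * u c j ^+ 2 else 0)).
  rewrite -big_mkcondr; apply: (@big_pred1 _ _ _ _ c) => c' /=; rewrite andbC.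
  by case: eqP => // ->.
by move=> c' _; exact: E.
Qed.

(** [rho] is the affinity of two random signs of means [u] and [v], and [1 - rho] is half a sum of
    squared differences of square roots. The bound [1 / 2] on the means gives
    [1 <= (p + q) ^ 2 <= 3] for these roots, so [p - q] is comparable with [p ^ 2 - q ^ 2]. *)
Lemma bernoulli_affinity (K : rcfType) (u v : K) : `|u| <= 2^-1 -> `|v| <= 2^-1 ->
  let rho := Num.sqrt ((1 + u) / 2) * Num.sqrt ((1 + v) / 2) +
             Num.sqrt ((1 - u) / 2) * Num.sqrt ((1 - v) / 2) in
  (u - v) ^+ 2 / 12 <= 1 - rho <= (u - v) ^+ 2 / 4.
Proof.
rewrite !ler_norml => /andP[u1 u2] /andP[v1 v2].
set a := Num.sqrt ((1 + u) / 2); set b := Num.sqrt ((1 + v) / 2).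
set c := Num.sqrt ((1 - u) / 2); set e := Num.sqrt ((1 - v) / 2) => /=.
have a2 : a ^+ 2 = (1 + u) / 2 by rewrite sqr_sqrtr//; lra.
have b2 : b ^+ 2 = (1 + v) / 2 by rewrite sqr_sqrtr//; lra.
have c2 : c ^+ 2 = (1 - u) / 2 by rewrite sqr_sqrtr//; lra.
have e2 : e ^+ 2 = (1 - v) / 2 by rewrite sqr_sqrtr//; lra.
have a0 : 0 <= a by exact: sqrtr_ge0.
have b0 : 0 <= b by exact: sqrtr_ge0.
have c0 : 0 <= c by exact: sqrtr_ge0.
have e0 : 0 <= e by exact: sqrtr_ge0.
have key (p q : K) : 0 <= p -> 0 <= q -> 4^-1 <= p ^+ 2 <= 3 / 4 -> 4^-1 <= q ^+ 2 <= 3 / 4 ->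
    (p ^+ 2 - q ^+ 2) ^+ 2 / 3 <= (p - q) ^+ 2 <= (p ^+ 2 - q ^+ 2) ^+ 2.
  move=> p0 q0 /andP[p1 p2] /andP[q1 q2].
  have -> : (p ^+ 2 - q ^+ 2) ^+ 2 = (p - q) ^+ 2 * (p + q) ^+ 2 by ring.
  have d0 : 0 <= (p - q) ^+ 2 by exact: sqr_ge0.
  have hp : 2^-1 <= p by nra.
  have hq : 2^-1 <= q by nra.
  have s1 : 1 <= (p + q) ^+ 2 by nra.
  have s2 : (p + q) ^+ 2 <= 3 by nra.
  apply/andP; split; nra.
have /andP[k1 k2] : (a ^+ 2 - b ^+ 2) ^+ 2 / 3 <= (a - b) ^+ 2 <= (a ^+ 2 - b ^+ 2) ^+ 2.
  by apply: key => //; rewrite ?a2 ?b2; apply/andP; split; lra.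
have /andP[k3 k4] : (c ^+ 2 - e ^+ 2) ^+ 2 / 3 <= (c - e) ^+ 2 <= (c ^+ 2 - e ^+ 2) ^+ 2.
  by apply: key => //; rewrite ?c2 ?e2; apply/andP; split; lra.
have -> : 1 - (a * b + c * e) = ((a - b) ^+ 2 + (c - e) ^+ 2) / 2.
  have : a ^+ 2 + c ^+ 2 + (b ^+ 2 + e ^+ 2) = 2 by rewrite a2 b2 c2 e2; field.
  by move=> h; lra.
move: k1 k2 k3 k4; rewrite a2 b2 c2 e2.
have -> : ((1 + u) / 2 - (1 + v) / 2) ^+ 2 = (u - v) ^+ 2 / 4 by field.
have -> : ((1 - u) / 2 - (1 - v) / 2) ^+ 2 = (u - v) ^+ 2 / 4 by field.
by move=> k1 k2 k3 k4; apply/andP; split; lra.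
Qed.

(** Cauchy-Schwarz on [|f - g| = |sqrt f - sqrt g| * |sqrt f + sqrt g|] gives
    [(2 - 2 * rho) * (2 + 2 * rho)], and [rho <= 1]. *)
Lemma sum_dist_le_affinity (K : rcfType) (Z : finType) (f g : Z -> K) :
  (forall z, 0 <= f z) -> (forall z, 0 <= g z) ->
  \sum_z f z = 1 -> \sum_z g z = 1 ->
  (\sum_z `|f z - g z|) ^+ 2 <= 8 * (1 - \sum_z Num.sqrt (f z) * Num.sqrt (g z)).
Proof.
move=> f0 g0 f1 g1; set rho := \sum_z _ * _.
rewrite (eq_bigr (fun z => `|Num.sqrt (f z) - Num.sqrt (g z)| *
    `|Num.sqrt (f z) + Num.sqrt (g z)|)); last first.
  by move=> z _; rewrite -normrM -subr_sqr !sqr_sqrtr.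
apply: le_trans (sqr_sumM_le _ _) _.
have E (e : K) : (e ^+ 2 = 1) -> \sum_z `|Num.sqrt (f z) + e * Num.sqrt (g z)| ^+ 2 = 2 + 2 * e * rho.
  move=> e2; rewrite (eq_bigr (fun z => f z + g z + 2 * e * (Num.sqrt (f z) * Num.sqrt (g z)))).
    by rewrite !big_split/= f1 g1 -mulr_sumr.
  move=> z _; rewrite real_normK ?num_real// sqrrD exprMn !sqr_sqrtr// e2; ring.
have -> : \sum_z `|Num.sqrt (f z) - Num.sqrt (g z)| ^+ 2 = 2 - 2 * rho.
  rewrite (eq_bigr (fun z => `|Num.sqrt (f z) + -1 * Num.sqrt (g z)| ^+ 2)).
    by rewrite E ?sqrrN ?expr1n// mulrN1 mulNr.
  by move=> z _; rewrite mulN1r.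
have r0 : 0 <= 2 - 2 * rho.
  have := E (-1); rewrite sqrrN expr1n => /(_ erefl).
  rewrite mulrN1 mulNr => <-; apply: sumr_ge0 => z _; exact: sqr_ge0.
have -> : \sum_z `|Num.sqrt (f z) + Num.sqrt (g z)| ^+ 2 = 2 + 2 * rho.
  rewrite (eq_bigr (fun z => `|Num.sqrt (f z) + 1 * Num.sqrt (g z)| ^+ 2)).
    by rewrite E ?expr1n// mulr1.
  by move=> z _; rewrite mul1r.
by nra.
Qed.

(** * A finite substitute for Gaussian smoothing *)

Lemma bounded_family_nat (K : archiRealFieldType) (I : finType) (g : I -> K) :
  exists2 M : nat, (0 < M)%nat & forall i, `|g i| <= M%:R.
Proof.
exists (Num.bound (\sum_i `|g i|)).+1 => // i.
have g0 : 0 <= \sum_i `|g i| by apply: sumr_ge0.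
apply: (@le_trans _ _ (\sum_i `|g i|)).
  by rewrite (bigD1 i)//= lerDl sumr_ge0.
by rewrite (le_trans (ltW (archi_boundP g0)))// ler_nat.
Qed.

(* Replacing each coordinate by [M * M] independent signs of mean proportional
   to it plays the role of adding Gaussian noise of standard deviation [1 / a]
   in each coordinate; [e] is the empirical mean read off from the signs. *)
Lemma sign_kernel (K : realType) (n d : nat) (x : 'I_n -> 'I_d -> K) (a : K) :
  0 < a ->
  exists (Z : finType) (z0 : Z) (f : 'I_n -> Z -> K) (e : Z -> 'I_d -> K),
   [/\ forall i z, 0 <= f i z, forall i, \sum_z f i z = 1,
    forall i j, (\sum_z `|f i z - f j z|) ^+ 2
      <= 2 * a ^+ 2 * \sum_k (x i k - x j k) ^+ 2,
    forall i j, \sum_z Num.sqrt (f i z) * Num.sqrt (f j z)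
      <= expR (- (a ^+ 2 * (\sum_k (x i k - x j k) ^+ 2) / 12)) &
    forall i, \sum_z f i z * (\sum_k (e z k - x i k) ^+ 2) <= d%:R / a ^+ 2].
Proof.
move=> a0.
(* [M] keeps the sign means [b * x i k] within [1 / 2], as the affinity estimate requires. Taking
   [M * M] signs per coordinate gives [N * b ^ 2 = a ^ 2], so the final bounds depend on [a]
   only. *)
have [M M0 xM] := bounded_family_nat (fun p : 'I_n * 'I_d => 2 * a * x p.1 p.2).
have MR : 0 < M%:R :> K by rewrite ltr0n.
pose N := (M * M)%nat.
have NE : N%:R = M%:R ^+ 2 :> K by rewrite natrM expr2.
pose b := a / M%:R.
have b0 : 0 < b by rewrite divr_gt0.
have bx i k : `|b * x i k| <= 2^-1.
  have := xM (i, k); rewrite /= 2!normrM (gtr0_norm a0) gtr0_norm// => h.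
  by rewrite normrM (gtr0_norm b0) mulrAC ler_pdivrMr//; lra.
pose C := ('I_d * 'I_N)%type.
have cardC (k : 'I_d) : #|(fun c : C => c.1 == k)| = N.
  rewrite (_ : #|_| = #|finset.setX (finset.set1 k) [set: 'I_N]|).
    by rewrite finset.cardsX finset.cards1 mul1n finset.cardsT card_ord.
  by apply: eq_card => -[k' l]; rewrite !inE andbT.
pose sg (t : bool) : K := if t then 1 else -1.
pose nu i (c : C) t := (1 + sg t * (b * x i c.1)) / 2.
have nu0 i c t : 0 <= nu i c t.
  have := bx i c.1; rewrite ler_norml => /andP[h1 h2].
  by rewrite /nu /sg; case: t; rewrite divr_ge0//; lra.
have sumb (g : bool -> K) : \sum_t g t = g true + g false by rewrite big_bool.
have nu1 i c : \sum_t nu i c t = 1 by rewrite sumb /nu /sg; field.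
pose f i (z : {ffun C -> bool}) := \prod_c nu i c (z c).
pose e (z : {ffun C -> bool}) (k : 'I_d) :=
  (\sum_(c | c.1 == k) sg (z c)) / (b * N%:R).
have f1 i : \sum_z f i z = 1 by rewrite -bigA_distr_bigA big1.
have f0 i z : 0 <= f i z by apply: prodr_ge0.
have sumC (g : 'I_d -> K) : \sum_(c : C) g c.1 = N%:R * \sum_k g k.
  rewrite -(pair_bigA _ (fun k (l : 'I_N) => g k))/= mulr_sumr.
  by apply: eq_bigr => k _; rewrite sumr_const card_ord mulr_natl.
have ab : N%:R * b ^+ 2 = a ^+ 2.
  by rewrite /b NE; field; rewrite gt_eqF.
pose r i j (c : C) := \sum_t Num.sqrt (nu i c t) * Num.sqrt (nu j c t).
have rP i j c : (b * x i c.1 - b * x j c.1) ^+ 2 / 12 <= 1 - r i j c <=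
    (b * x i c.1 - b * x j c.1) ^+ 2 / 4.
  have := bernoulli_affinity (bx i c.1) (bx j c.1).
  by rewrite /r sumb /nu /sg !mul1r !mulN1r.
have aff i j : \sum_z Num.sqrt (f i z) * Num.sqrt (f j z) = \prod_c r i j c.
  rewrite bigA_distr_bigA; apply: eq_bigr => z _.
  have sqrt_prod i' : Num.sqrt (f i' z) = \prod_c Num.sqrt (nu i' c (z c)).
    suff [] : 0 <= f i' z /\ Num.sqrt (f i' z) = \prod_c Num.sqrt (nu i' c (z c)) by [].
    rewrite /f; elim/big_rec2: _ => [|c p q _ [q0 <-]]; first by rewrite sqrtr1.
    by rewrite mulr_ge0// sqrtrM.
  by rewrite !sqrt_prod big_split.
have r0 i j c : 0 <= r i j c by apply: sumr_ge0 => t _; rewrite mulr_ge0.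
exists {ffun C -> bool}, [ffun=> true], f, e; split => //.
- move=> i j; apply: le_trans (sum_dist_le_affinity (f0 i) (f0 j) (f1 i) (f1 j)) _.
  rewrite aff.
  have h : 1 - \sum_c (1 - r i j c) <= \prod_c r i j c.
    apply: prod_ge_1sub_sum => c; rewrite r0 /=.
    have /andP[+ _] := rP i j c; have := sqr_ge0 (b * x i c.1 - b * x j c.1); lra.
  have : \sum_c (1 - r i j c) <= \sum_(c : C) (b * x i c.1 - b * x j c.1) ^+ 2 / 4.
    by apply: ler_sum => c _; have /andP[] := rP i j c.
  rewrite (sumC (fun k => (b * x i k - b * x j k) ^+ 2 / 4)).
  rewrite (eq_bigr (fun k => b ^+ 2 / 4 * (x i k - x j k) ^+ 2)); last by move=> k _; field.
  rewrite -mulr_sumr; set sq := \sum_(k < d) _.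
  have -> : N%:R * (b ^+ 2 / 4 * sq) = a ^+ 2 * sq / 4 by rewrite -ab; field.
  by move: h; lra.
- move=> i j; rewrite aff; apply: le_trans (prod_le_expR (r0 i j)) _.
  rewrite ler_expR lerN2.
  have : \sum_(c : C) (b * x i c.1 - b * x j c.1) ^+ 2 / 12 <= \sum_c (1 - r i j c).
    by apply: ler_sum => c _; have /andP[] := rP i j c.
  rewrite (sumC (fun k => (b * x i k - b * x j k) ^+ 2 / 12)).
  rewrite (eq_bigr (fun k => b ^+ 2 / 12 * (x i k - x j k) ^+ 2)); last by move=> k _; field.
  rewrite -mulr_sumr; set sq := \sum_(k < d) _.
  by have -> : N%:R * (b ^+ 2 / 12 * sq) = a ^+ 2 * sq / 12 by rewrite -ab; field.
- move=> i; pose u (c : C) t := sg t - b * x i c.1.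
  have M2 : 0 < N%:R :> K by rewrite NE exprn_gt0.
  have ek z k : (e z k - x i k) ^+ 2 =
      (b * N%:R) ^- 2 * (\sum_(c | c.1 == k) u c (z c)) ^+ 2.
    have -> : \sum_(c : C | c.1 == k) u c (z c) = \sum_(c : C | c.1 == k) sg (z c) - b * N%:R * x i k.
      rewrite sumrB; congr (_ - _).
      rewrite (eq_bigr (fun=> b * x i k)); last by move=> c /eqP <-.
      by rewrite sumr_const cardC [RHS]mulrAC [RHS]mulr_natr.
    by rewrite /e; field; rewrite !gt_eqF.
  rewrite (eq_bigr (fun z => \sum_k (b * N%:R) ^- 2 * (f i z *
      (\sum_(c | c.1 == k) u c (z c)) ^+ 2))); last first.
    by move=> z _; rewrite mulr_sumr; apply: eq_bigr => k _; rewrite ek mulrCA.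
  rewrite exchange_big/=.
  (* Each sign has variance at most [1], so [N] of them give [N / (b * N) ^ 2 = a ^- 2] per
     coordinate. *)
  have var c : \sum_t nu i c t * u c t ^+ 2 <= 1.
    rewrite sumb /nu /u /sg; have := sqr_ge0 (b * x i c.1); nra.
  have u0 c : \sum_t nu i c t * u c t = 0 by rewrite sumb /nu /u /sg; field.
  have bnd k : \sum_z (b * N%:R) ^- 2 * (f i z * (\sum_(c | c.1 == k) u c (z c)) ^+ 2)
      <= a ^- 2.
    rewrite -mulr_sumr (sum_prod_variance (fun c : C => c.1 == k) (nu1 i) u0).
    have -> : a ^- 2 = (b * N%:R) ^- 2 * N%:R.
      by rewrite -ab; field; rewrite !gt_eqF.
    rewrite ler_wpM2l ?invr_ge0 ?sqr_ge0//.
    apply: le_trans (ler_sum _ (fun c _ => var c)) _.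
    by rewrite sumr_const cardC.
  apply: le_trans (ler_sum _ (fun k _ => bnd k)) _.
  by rewrite sumr_const card_ord mulr_natl.
Qed.

(* Otherwise numerals and products in arguments of type [R] would be parsed in
   Stdlib's [R_scope], as [IZR _] and [Rmult], instead of in [ring_scope]. *)
Arguments lp_dist : clear scopes.

(** * Decompositions of Euclidean point sets *)

(** Quantifying over all families and all scales allows its use on the images of the points under
    the Mazur map, at a scale of their own. *)
Definition lp_decomposable (n d : nat) (p beta : R) : Prop :=
  forall (x : 'I_n -> 'I_d -> R) (Delta : R), 0 < Delta ->
  exists mu, lipschitz_decomposition (fun i j => lp_dist p (x i) (x j)) beta Delta mu.

Arguments lp_decomposable : clear scopes.

Lemma le_of_sqr (K : realDomainType) (x y : K) : 0 <= y -> x ^+ 2 <= y ^+ 2 -> x <= y.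
Proof. by move=> y0 xy; rewrite leNgt; apply/negP => yx; nra. Qed.

Lemma cutoff_lipschitz (K : realDomainType) (t u v l : K) :
  0 <= t -> u <= v + l -> v <= u + l ->
  `|Num.max 0 (1 - t * u) - Num.max 0 (1 - t * v)| <= t * l.
Proof.
move=> t0 /(ler_wpM2l t0) uv /(ler_wpM2l t0) vu; rewrite mulrDr in uv vu.
rewrite ler_norml; apply/andP; have tl : 0 <= t * l by lra.
by split; case: (lerP 0 (1 - t * u)) => h1; case: (lerP 0 (1 - t * v)) => h2; lra.
Qed.

Lemma lp_dist_ge0 (p : R) (d : nat) (u v : 'I_d -> R) : 0 <= lp_dist p u v.
Proof. exact: powR_ge0. Qed.

Lemma lp_distC (p : R) (d : nat) (u v : 'I_d -> R) : lp_dist p u v = lp_dist p v u.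
Proof. by congr (_ `^ _); apply: eq_bigr => k _; rewrite distrC. Qed.

Lemma lp_dist2_sqr (d : nat) (u v : 'I_d -> R) :
  lp_dist 2 u v ^+ 2 = \sum_k (u k - v k) ^+ 2.
Proof.
have s0 : 0 <= \sum_k `|u k - v k| `^ 2 by apply: sumr_ge0 => k _; exact: powR_ge0.
rewrite /lp_dist powR12_sqrt// sqr_sqrtr//.
by apply: eq_bigr => k _; rewrite powR_mulrn// real_normK// num_real.
Qed.

Lemma lp_dist2_triangle (d : nat) (u v w : 'I_d -> R) :
  lp_dist 2 u w <= lp_dist 2 u v + lp_dist 2 v w.
Proof.
set A := lp_dist 2 u v; set B := lp_dist 2 v w.
have A0 : 0 <= A by exact: lp_dist_ge0.
have B0 : 0 <= B by exact: lp_dist_ge0.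
apply: le_of_sqr; first exact: (addr_ge0 A0 B0).
have cs : \sum_k (u k - v k) * (v k - w k) <= A * B.
  have := sqr_sumM_le (fun k => u k - v k) (fun k => v k - w k).
  rewrite -!lp_dist2_sqr -exprMn -/A -/B => h.
  have AB0 := mulr_ge0 A0 B0; nra.
rewrite lp_dist2_sqr (eq_bigr (fun k => (u k - v k) ^+ 2 + (v k - w k) ^+ 2 +
  2 * ((u k - v k) * (v k - w k)))); last by move=> k _; ring.
rewrite !big_split/= -mulr_sumr -!lp_dist2_sqr -/A -/B; nra.
Qed.

(** The kernel is multiplied by a cutoff vanishing from distance [Delta / 2] on; being linear in the
    distance before that, it keeps the product Lipschitz in the point. With [a = 4 * s / Delta] the
    mean square deviation is at most [Delta ^ 2 / 16], so at least half of the mass survives. *)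
Lemma l2_decomposition_dim (n d : nat) :
  (1 <= d)%nat -> lp_decomposable n d 2 (24 * Num.sqrt d%:R).
Proof.
move=> d1 x Delta D0.
set s : R := Num.sqrt d%:R.
have s2 : s ^+ 2 = d%:R by rewrite sqr_sqrtr.
have s0 : 0 <= s by exact: sqrtr_ge0.
have d1R : 1 <= d%:R :> R by rewrite ler1n.
have s1 : 1 <= s by nra.
pose a := 4 * s / Delta.
have a0 : 0 < a by rewrite divr_gt0// mulr_gt0//; lra.
have [Z [z0 [f [e [f0 f1 fC _ fV]]]]] := sign_kernel x a0.
pose D z i := lp_dist 2 (e z) (x i).
pose chi i z := Num.max 0 (1 - 2 / Delta * D z i).
pose h i z := f i z * chi i z.
have chi0 i z : 0 <= chi i z by rewrite le_max lexx.
have Dge0 z i : 0 <= D z i by exact: lp_dist_ge0.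
have chi1 i z : chi i z <= 1.
  by rewrite ge_max ler01 gerBl mulr_ge0// divr_ge0// ltW.
have h0 i z : 0 <= h i z by rewrite mulr_ge0.
have chiL i j z : `|chi i z - chi j z| <= 2 / Delta * lp_dist 2 (x i) (x j).
  have t1 := lp_dist2_triangle (e z) (x i) (x j).
  have t2 := lp_dist2_triangle (e z) (x j) (x i).
  have t3 := lp_distC 2 (x i) (x j).
  rewrite -/(D z i) -/(D z j) in t1 t2.
  have c0 : 0 < 2 / Delta by rewrite divr_gt0.
  apply: (cutoff_lipschitz (ltW c0)) => [|]; last exact: t1.
  rewrite t3; exact: t2.
have mass i : 2^-1 <= \sum_z h i z.
  (* With [c = 2 / Delta], the inequality [1 - c * y >= 3 / 4 - (c * y) ^ 2] turns the mean-square
     bound into a mass of at least [3 / 4 - 1 / 4]. *)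
  have le1 z : 3 / 4 * f i z - 4 / Delta ^+ 2 * (f i z * \sum_k (e z k - x i k) ^+ 2) <= h i z.
    rewrite -lp_dist2_sqr -/(D z i).
    have -> : 4 / Delta ^+ 2 = (2 / Delta) ^+ 2 by field; rewrite gt_eqF.
    rewrite /h /chi; move: (f i z) (f0 i z) (D z i) (2 / Delta) => F F0 y c.
    have : F * (1 - c * y) <= F * Num.max 0 (1 - c * y).
      by apply: ler_wpM2l => //; rewrite le_max lexx orbT.
    by have := mulr_ge0 F0 (sqr_ge0 (c * y - 2^-1)); lra.
  apply: le_trans (ler_sum _ (fun z _ => le1 z)); rewrite sumrB -!mulr_sumr f1.
  have : 4 / Delta ^+ 2 * (\sum_z f i z * \sum_k (e z k - x i k) ^+ 2) <= 4^-1.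
    apply: le_trans (ler_wpM2l _ (fV i)) _; first by rewrite divr_ge0// sqr_ge0.
    rewrite -s2 /a le_eqVlt; apply/orP; left; apply/eqP; field.
    by rewrite !gt_eqF//; lra.
  by lra.
have half0 : 0 < 2^-1 :> R by lra.
have [nu [nu0 nu1 nuM nuC]] := consistent_rounding_on z0 half0 h0 mass [set: 'I_n].
apply: (@lipschitz_decomposition_of_labels _ _ _ _ _ _ nu (fun w => w)) => //.
(* A label of positive probability has positive cutoff, so its centre [e (w i)] is within
   [Delta / 2] of [x i]; equal labels share the centre. *)
- have near w i : 0 < nu w -> D (w i) i <= Delta / 2.
    move=> w0; have : 0 < h i (w i) / \sum_z h i z.
      rewrite -nuM ?finset.inE// (bigD1 w)//=.
      by apply: (lt_le_trans w0); rewrite lerDl sumr_ge0.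
    have mi : 0 < \sum_z h i z := lt_le_trans half0 (mass i).
    rewrite pmulr_lgt0 ?invr_gt0// /h /chi => hw.
    rewrite leNgt; apply/negP => lt; move: hw; rewrite max_l ?mulr0 ?ltxx//.
    by move: lt; move: (D (w i) i) => y lt; rewrite subr_le0 mulrAC ler_pdivlMr//; lra.
  move=> w w0 i j eqz; have := near w i w0; have := near w j w0; rewrite -eqz => nj ni.
  apply: le_trans (lp_dist2_triangle _ (e (w i)) _) _.
  by rewrite lp_distC [leRHS]splitr; exact: (lerD ni nj).
- move=> i j; apply: le_trans (nuC i j _ _) _; rewrite ?finset.inE//.
  set L := lp_dist 2 (x i) (x j); have L0 : 0 <= L by exact: lp_dist_ge0.
  have hL : \sum_z `|h i z - h j z| <= (\sum_z `|f i z - f j z|) + 2 / Delta * L.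
    have -> : 2 / Delta * L = \sum_z f j z * (2 / Delta * L) by rewrite -mulr_suml f1 mul1r.
    rewrite -big_split/=; apply: ler_sum => z _.
    have -> : h i z - h j z = (f i z - f j z) * chi i z + f j z * (chi i z - chi j z).
      by rewrite /h; move: (chi i z) (chi j z) => p q; ring.
    apply: le_trans (ler_normD _ _) _; rewrite !normrM (ger0_norm (chi0 i z)) (ger0_norm (f0 j z)).
    by apply: lerD; [rewrite ler_piMr | rewrite ler_wpM2l].
  have fL : \sum_z `|f i z - f j z| <= 2 * a * L.
    have := fC i j; rewrite -lp_dist2_sqr -/L => h1.
    apply: le_of_sqr; first exact: (mulr_ge0 (mulr_ge0 (ler0n _ 2) (ltW a0)) L0).
    by apply: le_trans h1 _; have := sqr_ge0 (a * L); nra.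
  (* The rate is [2 * (2 * a + 2 / Delta) = (16 * s + 4) / Delta], at most [24 * s / Delta] since
     [s >= 1]. *)
  rewrite invrK; apply: (@le_trans _ _ ((2 * a * L + 2 / Delta * L) * 2)); first lra.
  have -> : (2 * a * L + 2 / Delta * L) * 2 = (16 * s + 4) * (L / Delta) by rewrite /a; field; rewrite gt_eqF.
  rewrite -[leRHS]mulrA; apply: ler_wpM2r; last by lra.
  by rewrite divr_ge0// ltW.
Qed.

(* Points at distance more than [Delta] share a label with probability at most
   [n^-3], so no such pair does with probability at least [1 / 2]; conditioning
   on this event at most doubles the separation probabilities. *)
Lemma l2_decomposition_card (n d : nat) :
  (2 <= n)%nat -> lp_decomposable n d 2 (24 * Num.sqrt (ln n%:R)).
Proof.
move=> n2 x Delta D0.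
have n0 : 0 < n%:R :> R by rewrite ltr0n; apply: leq_trans n2.
have nR : 2 <= n%:R :> R by rewrite ler_nat.
have ln0 : 0 < ln (n%:R : R) by rewrite ln_gt0//; lra.
set s : R := Num.sqrt (ln n%:R).
have s2 : s ^+ 2 = ln n%:R by rewrite sqr_sqrtr// ltW.
have s0 : 0 < s by rewrite sqrtr_gt0.
(* Chosen so that [a ^ 2 * Delta ^ 2 / 12 = 3 * ln n], which produces [n ^- 3]. *)
pose a := 6 * s / Delta.
have a0 : 0 < a by rewrite divr_gt0// mulr_gt0//; lra.
have [Z [z0 [f [e [f0 f1 fC fA _]]]]] := sign_kernel x a0.
have mass i : 1 <= \sum_z f i z by rewrite f1.
have [nu [nu0 nu1 nuM nuC]] := consistent_rounding_on z0 (@ltr01 R) f0 mass [set: 'I_n].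
pose far i j := Delta < lp_dist 2 (x i) (x j).
pose bad (w : {ffun 'I_n -> Z}) := [exists i, [exists j, far i j && (w i == w j)]].
(* The probability that both labels equal [z] is at most either marginal, hence at most
   [sqrt (f i z * f j z)]; summing over [z] gives the affinity. *)
have pair_le i j : far i j -> \sum_(w : {ffun 'I_n -> Z} | w i == w j) nu w <= n%:R ^- 3.
  move=> fij; rewrite (partition_big (fun w : {ffun 'I_n -> Z} => w i) xpredT)//=.
  apply: (@le_trans _ _ (expR (- (a ^+ 2 * (lp_dist 2 (x i) (x j)) ^+ 2 / 12)))).
    rewrite lp_dist2_sqr; apply: le_trans (fA i j); apply: ler_sum => z _.
    set t := \sum_(_ | _) _.
    have t0 : 0 <= t by apply: sumr_ge0.
    have ti : t <= f i z.
      have := nuM i z (finset.in_setT i); rewrite f1 divr1 => <-.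
      rewrite [leRHS](bigID (fun w : {ffun 'I_n -> Z} => w i == w j))/=.
      by rewrite /t [leLHS](eq_bigl _ _ (fun w => andbC _ _)) lerDl sumr_ge0.
    have tj : t <= f j z.
      have := nuM j z (finset.in_setT j); rewrite f1 divr1 => <-.
      rewrite [leRHS](bigID (fun w : {ffun 'I_n -> Z} => w i == w j))/= /t.
      rewrite [leLHS](eq_bigl (fun w : {ffun 'I_n -> Z} => (w j == z) && (w i == w j))).
        by rewrite lerDl sumr_ge0.
      by move=> w; rewrite andbC; case: (eqVneq (w i) (w j)) => [->|]; rewrite ?andbF.
    by rewrite -sqrtrM// -[t](ger0_norm t0) -sqrtr_sqr ler_wsqrtr// expr2 ler_pM.
  have -> : n%:R ^- 3 = expR (- (3 * ln n%:R)) :> R.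
    by rewrite expRN expRM_natl lnK.
  rewrite ler_expR lerN2 -s2.
  have Dl : Delta ^+ 2 <= lp_dist 2 (x i) (x j) ^+ 2.
    by have := ltW D0; have := ltW fij; nra.
  have -> : 3 * s ^+ 2 = a ^+ 2 * Delta ^+ 2 / 12 by rewrite /a; field; rewrite gt_eqF.
  by rewrite ler_wpM2r// ler_wpM2l// sqr_ge0.
(* Union bound over ordered pairs: [n ^ 2 * n ^- 3 = 1 / n], at most [1 / 2] since [n >= 2]. *)
have bad_le : \sum_(w | bad w) nu w <= 2^-1.
  apply: (@le_trans _ _ (\sum_(i < n) \sum_(j < n | far i j) \sum_(w : {ffun 'I_n -> Z} | w i == w j) nu w)).
    rewrite (eq_bigr (fun i => \sum_(w : {ffun 'I_n -> Z}) \sum_(j | far i j && (w i == w j)) nu w)); last first.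
      by move=> i _; rewrite (exchange_big_dep xpredT).
    rewrite exchange_big/= [leRHS](bigID bad)/= ler_wpDr//.
      by apply: sumr_ge0 => w _; apply: sumr_ge0 => i _; apply: sumr_ge0.
    apply: ler_sum => w /existsP[i /existsP[j fij]].
    rewrite (bigD1 i)//= (bigD1 j)//= -addrA lerDl addr_ge0 ?sumr_ge0// => k _.
    by rewrite sumr_ge0.
  apply: (@le_trans _ _ (\sum_(i < n) \sum_(j < n) n%:R ^- 3)).
    apply: ler_sum => i _; rewrite [leRHS](bigID (far i))/=; apply: ler_wpDr.
      by apply: sumr_ge0 => j _; rewrite invr_ge0 exprn_ge0 ?ltW.
    by apply: ler_sum => j; exact: pair_le.
  rewrite !sumr_const card_ord.
  have -> : n%:R ^- 3 *+ n *+ n = n%:R^-1 :> R.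
    by rewrite -mulrnA -[LHS]mulr_natr natrM; field; rewrite gt_eqF.
  by rewrite lef_pV2 ?posrE.
pose G := \sum_(w | ~~ bad w) nu w.
have GE : \sum_(w | bad w) nu w + G = 1 by rewrite -nu1 [RHS](bigID bad).
have G2 : 2^-1 <= G by lra.
have G0 : 0 < G by lra.
apply: (@lipschitz_decomposition_of_labels _ _ _ _ _ _
  (fun w => if bad w then 0 else nu w / G) (fun w => w)) => //.
- by move=> w; case: ifP => // _; rewrite divr_ge0// ltW.
- rewrite (bigID bad)/= big1 ?add0r => [|w ->//].
  rewrite (eq_bigr (fun w => nu w / G)) => [|w /negPf->//].
  by rewrite -mulr_suml mulfV// gt_eqF.
- move=> w; case: ifP => [_|bw _ i j wij]; first by rewrite ltxx.
  rewrite leNgt; apply/negP => fij; move/negbT: bw; apply/negP; rewrite negbK /bad.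
  by apply/existsP; exists i; apply/existsP; exists j; rewrite /far fij wij eqxx.
- move=> i j; set L := lp_dist 2 (x i) (x j); have L0 : 0 <= L by exact: lp_dist_ge0.
  apply: (@le_trans _ _ (\sum_(w : {ffun 'I_n -> Z} | w i != w j) nu w * 2)).
    apply: ler_sum => w _; case: ifP => _; first by rewrite mulr_ge0.
    by rewrite ler_wpM2l// -[leRHS]invrK lef_pV2// posrE invr_gt0.
  rewrite -mulr_suml; have := nuC i j (finset.in_setT i) (finset.in_setT j).
  rewrite divr1 => h1.
  have fL : \sum_z `|f i z - f j z| <= 2 * a * L.
    have := fC i j; rewrite -lp_dist2_sqr -/L => h2.
    apply: le_of_sqr; first exact: (mulr_ge0 (mulr_ge0 (ler0n _ 2) (ltW a0)) L0).
    by apply: le_trans h2 _; have := sqr_ge0 (a * L); nra.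
  have -> : 24 * s * L / Delta = 2 * a * L * 2 by rewrite /a; field; rewrite gt_eqF.
  by rewrite ler_wpM2r//; apply: le_trans h1 fL.
Qed.

(** * Scalar inequalities for the Mazur map *)

Lemma powR_superadd (K : realType) (r a b : K) : 1 <= r -> 0 <= a -> 0 <= b ->
  a `^ r + b `^ r <= (a + b) `^ r.
Proof.
move=> r1 a0 b0; have r0 : 0 < r by lra.
rewrite -!(mulr_powRB1 _ r0)// ?addr_ge0// mulrDl lerD// ler_wpM2l//.
  by rewrite ge0_ler_powR ?nnegrE ?subr_ge0 ?addr_ge0 ?lerDl.
by rewrite ge0_ler_powR ?nnegrE ?subr_ge0 ?addr_ge0 ?lerDr.
Qed.

Lemma powR_add_le (K : realType) (r a b : K) : 1 <= r -> 0 <= a -> 0 <= b ->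
  (a + b) `^ r <= 2 `^ (r - 1) * (a `^ r + b `^ r).
Proof.
move=> r1 a0 b0; have r0 : 0 < r by lra.
have h0 : 0 <= 2^-1 :> K by lra.
have h1 : 2^-1 <= 1 :> K by lra.
have := @convex_powR K r r1 (Itv01 h0 h1) a b.
rewrite !inE /= !in_itv /= !andbT => /(_ a0 b0).
move=> h; rewrite convRE [X in X `^ _ <= _]convRE /= /unstable.onem in h; move: h.
have -> : 2^-1 * a + (1 - 2^-1) * b = 2^-1 * (a + b) by field.
have -> : 2^-1 * a `^ r + (1 - 2^-1) * b `^ r = 2^-1 * (a `^ r + b `^ r) by field.
rewrite powRM ?addr_ge0// => h.
have t0 : 0 < 2 `^ r :> K by rewrite powR_gt0.
have -> : 2 `^ (r - 1) = 2 `^ r * 2^-1 :> K.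
  by rewrite powRB ?powRr1// pnatr_eq0 implybT.
have e : 2 `^ r * 2^-1 `^ r = 1 :> K by rewrite -powRM// mulfV ?powR1// pnatr_eq0.
apply: (@le_trans _ _ (2 `^ r * (2^-1 `^ r * (a + b) `^ r))).
  by rewrite mulrA e mul1r.
by rewrite -mulrA ler_wpM2l// ltW.
Qed.

(** With [A] and [B] the powers of exponent [r - 1], [a * A - b * B = A * (a - b) + b * (A - B)].
    Since [t ^ (r - 2)] is nonincreasing for [r <= 2], [b * A <= a * B], which bounds the last term
    by [B * (a - b)]. *)
Lemma powR_sub_le (K : realType) (r a b : K) : 1 <= r <= 2 -> 0 <= b -> b <= a ->
  a `^ r - b `^ r <= 2 * (a `^ (r - 1) * (a - b)).
Proof.
move=> /andP[r1 r2] b0 ba; have a0 := le_trans b0 ba; have r0 : 0 < r by lra.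
rewrite -!(mulr_powRB1 _ r0)//.
set A := a `^ (r - 1); set B := b `^ (r - 1).
have BA : B <= A by rewrite ge0_ler_powR ?nnegrE ?subr_ge0.
have B0 : 0 <= B by exact: powR_ge0.
have cross : b * A <= a * B.
  have [bb|bb] := eqVneq b 0.
    by rewrite bb mul0r mulr_ge0.
  have split c : c != 0 -> 0 <= c -> c = c `^ (r - 1) * c `^ (2 - r).
    move=> cn c0; rewrite -powRD; last by rewrite cn implybT.
    by rewrite (_ : r - 1 + (2 - r) = 1) ?powRr1//; ring.
  have an : a != 0 by rewrite gt_eqF// (lt_le_trans _ ba)// lt_neqAle eq_sym bb.
  have -> : b * A = A * B * b `^ (2 - r).
    by rewrite {1}(split b bb b0) -/B mulrC mulrA.
  have -> : a * B = A * B * a `^ (2 - r).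
    by rewrite {1}(split a an a0) -/A mulrAC.
  rewrite ler_wpM2l ?mulr_ge0 ?(le_trans B0)//.
  by rewrite ge0_ler_powR ?nnegrE ?subr_ge0.
nra.
Qed.

(* The Mazur map acts coordinatewise by [signed_powR]. *)
Definition signed_powR (K : realType) (r t : K) : K := Num.sg t * `|t| `^ r.

(** Reduction to nonnegative reals: arguments of equal sign give differences of absolute values,
    opposite signs give sums. *)
Lemma signed_powR_cases (K : realType) (r a b : K) : 0 < r ->
  (`|a - b| = `| `|a| - `|b| | /\
   `|signed_powR r a - signed_powR r b| = `| `|a| `^ r - `|b| `^ r |) \/
  (`|a - b| = `|a| + `|b| /\
   `|signed_powR r a - signed_powR r b| = `|a| `^ r + `|b| `^ r).
Proof.
move=> r0.
have E (t : K) : signed_powR r t = if 0 <= t then `|t| `^ r else - (`|t| `^ r).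
  rewrite /signed_powR; have [t0|t0|->] := ltrgt0P t.
  - by rewrite gtr0_sg// mul1r.
  - by rewrite ltr0_sg// mulN1r.
  - by rewrite sgr0 mul0r powR0// gt_eqF.
have X (t : K) := powR_ge0 `|t| r; have Xa := X a; have Xb := X b.
have [a0|a0] := lerP 0 a; have [b0|b0] := lerP 0 b;
  rewrite !E ?a0 ?b0 ?(lt_geF a0) ?(lt_geF b0).
- by left; rewrite (ger0_norm a0) (ger0_norm b0).
- right; rewrite opprK (ger0_norm (addr_ge0 Xa Xb)) ger0_norm ?subr_ge0; last lra.
  by rewrite (ger0_norm a0) (ltr0_norm b0).
- right; rewrite -opprD normrN (ger0_norm (addr_ge0 Xa Xb)) ler0_norm; last lra.
  by rewrite (ltr0_norm a0) (ger0_norm b0) opprB addrC.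
- left; rewrite (ltr0_norm a0) (ltr0_norm b0) !opprK; split; rewrite -normrN.
    by congr (`| _ |); ring.
  by congr (`| _ |); ring.
Qed.

(** The Hoelder bound for the inverse map: superadditivity of the power for equal signs, midpoint
    convexity for opposite ones. *)
Lemma signed_powR_expand (K : realType) (r a b : K) : 1 <= r ->
  `|a - b| `^ r <= 2 `^ (r - 1) * `|signed_powR r a - signed_powR r b|.
Proof.
move=> r1; have r0 : 0 < r by lra.
have [[-> ->]|[-> ->]] := signed_powR_cases a b r0; last first.
  exact: powR_add_le.
have one : 1 <= 2 `^ (r - 1) :> K.
  by apply: (@le_trans _ _ (2 `^ 0)); [rewrite powRr0 | apply: ler_powR; lra].
apply: (@le_trans _ _ `| `|a| `^ r - `|b| `^ r |); last by rewrite ler_peMl.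
wlog ba : a b / `|b| <= `|a| => [hw|].
  have [/hw//|/ltW/hw] := leP `|b| `|a|.
  by rewrite distrC [leRHS]distrC.
have h1 : 0 <= `|a| - `|b| by rewrite subr_ge0.
have h2 : 0 <= `|a| `^ r - `|b| `^ r by rewrite subr_ge0 ge0_ler_powR ?nnegrE// ltW.
rewrite (ger0_norm h1) (ger0_norm h2).
by rewrite lerBrDr; have := @powR_superadd K r (`|a| - `|b|) `|b| r1; rewrite subrK subr_ge0; apply.
Qed.

Lemma signed_powR_lipschitz (K : realType) (r a b : K) : 1 <= r <= 2 ->
  `|signed_powR r a - signed_powR r b|
    <= 2 * ((`|a| + `|b|) `^ (r - 1) * `|a - b|).
Proof.
move=> r12; have /andP[r1 r2] := r12; have r0 : 0 < r by lra.
have [[-> ->]|[-> ->]] := signed_powR_cases a b r0; last first.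
  rewrite [(_ + _) `^ _ * _]mulrC mulr_powRB1 ?addr_ge0//.
  apply: le_trans (powR_superadd r1 (normr_ge0 a) (normr_ge0 b)) _.
  by rewrite ler_peMl ?powR_ge0//; lra.
wlog ba : a b / `|b| <= `|a| => [hw|].
  have [/hw//|/ltW/hw] := leP `|b| `|a|.
  by rewrite distrC [`| `|b| - _|]distrC [`|b| + _]addrC.
have h1 : 0 <= `|a| - `|b| by rewrite subr_ge0.
have h2 : 0 <= `|a| `^ r - `|b| `^ r by rewrite subr_ge0 ge0_ler_powR ?nnegrE// ltW.
rewrite (ger0_norm h1) (ger0_norm h2).
apply: le_trans (powR_sub_le r12 (normr_ge0 b) ba) _.
rewrite ler_wpM2l// ler_wpM2r ?subr_ge0// ge0_ler_powR ?nnegrE ?subr_ge0 ?addr_ge0//.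
by rewrite lerDl.
Qed.

(** At [r = 2] the constant is [1] instead of [2], from [a ^ 2 - b ^ 2 = (a + b) * (a - b)]. With
    this value doubling the exponent costs exactly [2 * 8 * 1 = 16], hence the fourth power of
    [p]. *)
Lemma signed_powR2_lipschitz (K : realType) (a b : K) :
  `|signed_powR 2 a - signed_powR 2 b| <= 1 * ((`|a| + `|b|) `^ (2 - 1) * `|a - b|).
Proof.
have -> : 2 - 1 = 1 :> K by ring.
rewrite mul1r powRr1 ?addr_ge0//.
have [[-> ->]|[-> ->]] := signed_powR_cases a b (ltr0n K 2); rewrite !powR_mulrn//.
  by rewrite subr_sqr normrM mulrC ger0_norm// addr_ge0.
have := normr_ge0 a; have := normr_ge0 b; nra.
Qed.

(** * Hoelder's inequality and the Mazur map on balls of [l_(r q)] *)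

(** Young's inequality termwise with exponents [r / (r - 1)] and [r]; the case [r = 1], where the
    first is infinite, is treated apart. *)
Lemma hoelder_powR1 (K : realType) (I : finType) (s t : I -> K) (r q : K) :
  1 <= r -> 0 < q -> (forall i, 0 <= s i) -> (forall i, 0 <= t i) ->
  \sum_i s i `^ (r * q) <= 1 -> \sum_i t i `^ (r * q) <= 1 ->
  \sum_i (s i `^ (r - 1) * t i) `^ q <= 1.
Proof.
move=> r1 q0 s0 t0 S1 T1; move: r1; rewrite le_eqVlt => /orP[/eqP r1|r1].
  apply: le_trans T1; apply: ler_sum => i _.
  by rewrite -r1 subrr powRr0 !mul1r.
have r0 : 0 < r by lra.
have r10 : 0 < r - 1 by lra.
have p0 : 0 < r / (r - 1) by rewrite divr_gt0.
have pr : (r / (r - 1))^-1 + r^-1 = 1 by field; rewrite !gt_eqF.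
have young i : (s i `^ (r - 1) * t i) `^ q <=
    s i `^ (r * q) * (r / (r - 1))^-1 + t i `^ (r * q) * r^-1.
  rewrite powRM ?powR_ge0//.
  apply: le_trans (conjugate_powR (powR_ge0 _ _) (powR_ge0 _ _) p0 r0 pr) _.
  rewrite -!powRrM; have -> : (r - 1) * (q * (r / (r - 1))) = r * q.
    by field; rewrite gt_eqF.
  by rewrite [q * r]mulrC.
apply: le_trans (ler_sum _ (fun i _ => young i)) _.
rewrite big_split/= -!mulr_suml.
apply: (@le_trans _ _ ((r / (r - 1))^-1 + r^-1)); last by rewrite pr.
apply: lerD.
  by rewrite ler_piMl// invr_ge0 ltW.
by rewrite ler_piMl// invr_ge0 ltW.
Qed.

Lemma hoelder_powR (K : realType) (I : finType) (s t : I -> K) (S T r q : K) :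
  1 <= r -> 0 < q -> (forall i, 0 <= s i) -> (forall i, 0 <= t i) ->
  0 <= S -> 0 <= T ->
  \sum_i s i `^ (r * q) <= S `^ (r * q) -> \sum_i t i `^ (r * q) <= T `^ (r * q) ->
  \sum_i (s i `^ (r - 1) * t i) `^ q <= (S `^ (r - 1) * T) `^ q.
Proof.
move=> r1 q0 s0 t0 S0 T0 hS hT.
have rq0 : 0 < r * q by rewrite mulr_gt0//; lra.
have zero (g : I -> K) : (forall i, 0 <= g i) ->
    \sum_i g i `^ (r * q) <= 0 `^ (r * q) -> forall i, g i = 0.
  move=> g0; rewrite powR0 ?gt_eqF// => h i.
  have : \sum_i g i `^ (r * q) == 0.
    by rewrite eq_le h sumr_ge0// => j _; exact: powR_ge0.
  rewrite psumr_eq0 => [/allP/(_ i (mem_index_enum i))|j _]; last exact: powR_ge0.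
  by move=> /eqP/powR_eq0_eq0.
have [Tz|Tn] := eqVneq T 0.
  rewrite Tz in hT; rewrite big1 ?powR_ge0// => i _.
  by rewrite (zero _ t0 hT) mulr0 powR0// gt_eqF.
have [Sz|Sn] := eqVneq S 0.
  (* For [r = 1] the factor [0 ^ (r - 1)] is [1] and not [0], so this case is separate. *)
  rewrite Sz in hS *; have [e1|e1] := eqVneq r 1.
    rewrite e1 mul1r in hT *; rewrite subrr !powRr0 mul1r; apply: le_trans hT.
    by apply: ler_sum => i _; rewrite powRr0 mul1r.
  rewrite big1 ?powR_ge0// => i _.
  by rewrite (zero _ s0 hS) powR0 ?subr_eq0// mul0r powR0// gt_eqF.
have Sp : 0 < S by rewrite lt_neqAle eq_sym Sn.
have Tp : 0 < T by rewrite lt_neqAle eq_sym Tn.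
have scale (g : I -> K) G : 0 < G -> (forall i, 0 <= g i) ->
    \sum_i g i `^ (r * q) <= G `^ (r * q) -> \sum_i (g i / G) `^ (r * q) <= 1.
  move=> Gp g0 h; have P : 0 < G `^ (r * q) by rewrite powR_gt0.
  rewrite -(ler_pM2l P) mulr1 mulr_sumr; apply: le_trans h.
  apply: ler_sum => i _; rewrite -powRM ?divr_ge0// ?(ltW Gp)//.
  by rewrite mulrCA mulfV ?mulr1 ?gt_eqF.
have := hoelder_powR1 r1 q0 (fun i => divr_ge0 (s0 i) S0) (fun i => divr_ge0 (t0 i) T0)
  (scale _ _ Sp s0 hS) (scale _ _ Tp t0 hT).
have P : 0 < (S `^ (r - 1) * T) `^ q by rewrite powR_gt0// mulr_gt0// powR_gt0.
rewrite -(ler_pM2l P) mulr1 mulr_sumr; apply: le_trans.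
apply: ler_sum => i _.
rewrite -powRM ?mulr_ge0 ?powR_ge0 ?divr_ge0//.
rewrite mulrACA -powRM ?divr_ge0//.
have cancel (G c : K) : G != 0 -> G * (c / G) = c.
  by move=> Gn; rewrite mulrCA mulfV ?mulr1.
  by rewrite (cancel _ _ Sn) (cancel _ _ Tn).
by rewrite invr_ge0.
Qed.

Lemma lp_dist_le (p : R) (d : nat) (u v : 'I_d -> R) (t : R) : 0 < p -> 0 <= t ->
  (lp_dist p u v <= t) = (\sum_k `|u k - v k| `^ p <= t `^ p).
Proof.
move=> p0 t0; set s := \sum_k _.
have s0 : 0 <= s by apply: sumr_ge0 => k _; exact: powR_ge0.
have sE : lp_dist p u v `^ p = s by rewrite /lp_dist -powRrM mulVf ?powRr1// gt_eqF.
apply/idP/idP => [h|h].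
  by rewrite -sE; apply: ge0_ler_powR; rewrite ?nnegrE ?lp_dist_ge0 ?(ltW p0).
have {1}-> : t = (t `^ p) `^ p^-1 by rewrite -powRrM mulfV ?powRr1// gt_eqF.
by apply: ge0_ler_powR; rewrite ?nnegrE ?powR_ge0 ?invr_ge0 ?(ltW p0).
Qed.

Lemma lp_distxx (p : R) (d : nat) (u : 'I_d -> R) : 0 < p -> lp_dist p u u = 0.
Proof.
move=> p0; rewrite /lp_dist big1 ?powR0 ?invr_eq0 ?gt_eqF// => k _.
by rewrite subrr normr0 powR0// gt_eqF.
Qed.

(** The coordinatewise estimate is summed by Hoelder, the weights [|u k - z k| + |v k - z k|] having
    [l_(r q)] norm at most [2 * D]. *)
Lemma mazur_lipschitz (r q C D : R) (d : nat) (z u v : 'I_d -> R) :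
  1 <= r -> 0 < q -> 1 <= r * q -> 0 <= C -> 0 <= D ->
  (forall a b, `|signed_powR r a - signed_powR r b|
    <= C * ((`|a| + `|b|) `^ (r - 1) * `|a - b|)) ->
  lp_dist (r * q) u z <= D -> lp_dist (r * q) v z <= D ->
  lp_dist q (fun k => signed_powR r (u k - z k)) (fun k => signed_powR r (v k - z k))
    <= C * ((2 * D) `^ (r - 1) * lp_dist (r * q) u v).
Proof.
move=> r1 q0 p1 C0 D0 fC; have p0 : 0 < r * q by lra.
move=> hu hv; rewrite (lp_dist_le u z p0 D0) in hu; rewrite (lp_dist_le v z p0 D0) in hv.
set L := lp_dist _ u v; have L0 : 0 <= L by exact: lp_dist_ge0.
have hL : \sum_k `|u k - v k| `^ (r * q) <= L `^ (r * q) by rewrite -(lp_dist_le u v p0 L0).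
have M0 : 0 <= (2 * D) `^ (r - 1) * L by rewrite mulr_ge0// powR_ge0.
rewrite (lp_dist_le _ _ q0 (mulr_ge0 C0 M0)) (powRM _ C0 M0).
have hs : \sum_k (`|u k - z k| + `|v k - z k|) `^ (r * q) <= (2 * D) `^ (r * q).
  apply: le_trans (ler_sum _ (fun k _ => powR_add_le p1 (normr_ge0 _) (normr_ge0 _))) _.
  rewrite -mulr_sumr big_split/= powRM//.
  have -> : 2 `^ (r * q) = 2 `^ (r * q - 1) * 2 :> R.
    by rewrite [RHS]mulrC mulr_powRB1.
  by rewrite -mulrA ler_wpM2l ?powR_ge0//; lra.
have := hoelder_powR r1 q0 (fun k => addr_ge0 (normr_ge0 (u k - z k)) (normr_ge0 (v k - z k)))
  (fun k => normr_ge0 (u k - v k)) (mulr_ge0 (ler0n _ 2) D0) L0 hs hL.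
move=> /(ler_wpM2l (powR_ge0 C q)); apply: le_trans.
rewrite mulr_sumr; apply: ler_sum => k _.
rewrite -powRM// ?mulr_ge0 ?powR_ge0//.
have := fC (u k - z k) (v k - z k).
have -> : u k - z k - (v k - z k) = u k - v k by ring.
move=> h; apply: ge0_ler_powR; rewrite ?nnegrE ?(ltW q0)//.
by rewrite mulr_ge0// mulr_ge0// powR_ge0.
Qed.

(** Gives the scale at which the image has to be decomposed for the pulled back clusters to have
    diameter at most [D]. *)
Lemma mazur_expand (r q D : R) (d : nat) (z u v : 'I_d -> R) :
  1 <= r -> 0 < q -> 0 <= D ->
  lp_dist q (fun k => signed_powR r (u k - z k)) (fun k => signed_powR r (v k - z k))
    <= D `^ r / 2 `^ (r - 1) ->
  lp_dist (r * q) u v <= D.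
Proof.
move=> r1 q0 D0; have p0 : 0 < r * q by rewrite mulr_gt0//; lra.
have two : 0 < 2 `^ (r - 1) :> R by rewrite powR_gt0.
have M0 : 0 <= D `^ r / 2 `^ (r - 1) by rewrite divr_ge0 ?powR_ge0.
move=> h; rewrite (lp_dist_le _ _ q0 M0) in h; rewrite (lp_dist_le u v p0 D0).
rewrite powRrM.
have -> : (D `^ r) `^ q = (2 `^ (r - 1)) `^ q * (D `^ r / 2 `^ (r - 1)) `^ q.
  rewrite -powRM ?divr_ge0 ?powR_ge0//.
  by rewrite mulrCA mulfV ?mulr1// gt_eqF.
apply: le_trans (ler_wpM2l (powR_ge0 _ _) h).
rewrite mulr_sumr; apply: ler_sum => k _.
rewrite -powRM ?powR_ge0// powRrM; apply: ge0_ler_powR; rewrite ?nnegrE ?mulr_ge0 ?powR_ge0 ?(ltW q0)//.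
have := signed_powR_expand (u k - z k) (v k - z k) r1.
by have -> : u k - z k - (v k - z k) = u k - v k by ring.
Qed.

(** * Transfer from [l_q] to [l_(r q)] by recursion on scales *)

Lemma lipschitz_decomposition_trivial (n : nat) (dist : 'I_n -> 'I_n -> R)
    (beta Delta : R) :
  0 <= beta -> 0 < Delta -> (forall i j, 0 <= dist i j <= Delta) ->
  exists mu, lipschitz_decomposition dist beta Delta mu.
Proof.
move=> b0 D0 dD.
apply: (@lipschitz_decomposition_of_labels _ _ _ _ unit bool (fun=> 1) (fun _ _ => true)) => //.
- by rewrite big_const cardT enumT unlock /= addr0.
- by move=> _ _ i j _; have /andP[] := dD i j.
- move=> i j; rewrite big1//; have /andP[d0 _] := dD i j.
  by rewrite divr_ge0 ?mulr_ge0// ltW.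
Qed.

(* With [beta'] and [8 `^ (r - 1) * C * beta] the separation rates of the two
   stages, refining a decomposition of scale [2 * Delta] costs
   [beta' / 2 + 8 `^ (r - 1) * C * beta], so [beta'] is a fixed point as soon as
   it exceeds [2 * 8 `^ (r - 1) * C * beta]; the recursion on scales starts from
   the one-cluster partition. *)
Lemma mazur_step (n d : nat) (r q C beta beta' : R) :
  1 <= r -> 0 < q -> 1 <= r * q -> 0 <= C -> 0 <= beta ->
  (forall a b, `|signed_powR r a - signed_powR r b|
    <= C * ((`|a| + `|b|) `^ (r - 1) * `|a - b|)) ->
  2 * (8 `^ (r - 1) * C * beta) <= beta' ->
  lp_decomposable n d q beta -> lp_decomposable n d (r * q) beta'.
Proof.
move=> r1 q0 p1 C0 b0 fC hb' dec x.
pose gamma := 8 `^ (r - 1) * C * beta.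
have g0 : 0 <= gamma by rewrite !mulr_ge0// powR_ge0.
have b'0 : 0 <= beta' by apply: le_trans hb'; rewrite mulr_ge0.
have p0 : 0 < r * q by lra.
pose dist i j := lp_dist (r * q) (x i) (x j).
have dist0 i j : 0 <= dist i j by exact: lp_dist_ge0.
suff main m Delta : 0 < Delta -> (forall i j, dist i j <= 2 ^+ m * Delta) ->
    exists mu, lipschitz_decomposition dist beta' Delta mu.
  move=> Delta D0.
  have [M M0 hM] := bounded_family_nat (fun ij : 'I_n * 'I_n => dist ij.1 ij.2 / Delta).
  apply: (main M Delta D0) => i j.
  have := hM (i, j); rewrite /= ger0_norm ?divr_ge0 ?(ltW D0)//.
  rewrite ler_pdivrMr// => h; apply: le_trans h _.
  by rewrite ler_pM2r// -natrX ler_nat ltnW// ltn_expl.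
elim: m Delta => [|m IH] Delta D0 hD.
  apply: lipschitz_decomposition_trivial => // i j.
  by have := hD i j; rewrite expr0 mul1r dist0.
have DD0 : 0 < 2 * Delta by rewrite mulr_gt0.
have [|mu muP] := IH (2 * Delta) DD0.
  by move=> i j; rewrite mulrA -exprSr.
apply: (lipschitz_decomposition_refine D0 DD0 muP (gamma := gamma)) => //; last first.
  have -> : Delta / (2 * Delta) = 2^-1 by field; rewrite gt_eqF.
  by rewrite /gamma; lra.
move=> B.
(* When [B] has diameter at most [2 * Delta], any of its points is the centre of a ball of that
   radius containing [B]; the value for empty [B] is a dummy. *)
pose z : 'I_d -> R := if [pick i in B] is Some i then x i else fun=> 0.
pose y i k := signed_powR r (x i k - z k).
pose delta := Delta `^ r / 2 `^ (r - 1).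
have delta0 : 0 < delta by rewrite divr_gt0 ?powR_gt0.
have [nu [nu0 [nu1 [nuS nuC]]]] := dec y delta delta0.
exists nu; split; [exact: nu0 | exact: nu1 | move=> diamB].
have zB i : i \in B -> lp_dist (r * q) (x i) z <= 2 * Delta.
  rewrite /z; case: pickP => [i0 i0B|B0] iB; first exact: diamB.
  by have := B0 i; rewrite iB.
split=> [P nP i j iB jB eqB|i j iB jB].
  have [partP diamP] := nuS P nP.
  have /and3P[/eqP cP _ _] := partP.
  apply: (@mazur_expand r q Delta d z) => //; first exact: ltW.
  apply: (diamP (finset.pblock P i)); last by rewrite eqB finset.mem_pblock cP finset.inE.
    by rewrite finset.pblock_mem// cP finset.inE.
  by rewrite finset.mem_pblock cP finset.inE.
apply: le_trans (nuC i j) _.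
have := mazur_lipschitz r1 q0 p1 C0 (ltW DD0) fC (zB i iB) (zB j jB).
rewrite -/(dist i j) -/(y i) -/(y j).
move: (lp_dist q (y i) (y j)) (dist i j) (dist0 i j) => L D _ LD.
have four : 2 * (2 * Delta) = 4 * Delta by ring.
(* Here [(4 * Delta) ^ (r - 1) / delta = 8 ^ (r - 1) / Delta], whence the form of [gamma]. *)
apply: (@le_trans _ _ (beta * (C * ((4 * Delta) `^ (r - 1) * D)) / delta)).
  by rewrite -four ler_wpM2r ?invr_ge0 ?(ltW delta0)// ler_wpM2l.
rewrite le_eqVlt; apply/orP; left; apply/eqP.
rewrite /gamma /delta -(mulr_powRB1 (ltW D0) (lt_le_trans ltr01 r1)).
have -> : 8 = 4 * 2 :> R by ring.
rewrite !powRM ?(ltW D0)//.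
have t0 : 2 `^ (r - 1) != 0 :> R by rewrite gt_eqF// powR_gt0.
have D1 : Delta `^ (r - 1) != 0 by rewrite gt_eqF// powR_gt0.
by field; rewrite D1 t0 gt_eqF.
Qed.

(** * From exponent [2] to every [p >= 2] *)

Lemma lp_decomposable_small (n d : nat) (p beta : R) :
  (n <= 1)%nat -> 1 <= p -> 0 <= beta -> lp_decomposable n d p beta.
Proof.
move=> n1 p1 b0 x Delta D0; apply: lipschitz_decomposition_trivial => // i j.
have -> : i = j.
  apply: val_inj; move: (ltn_ord i) (ltn_ord j) n1.
  by case: n x i j => [|[]]//= _ [[]]//= ? [[]].
by rewrite lp_distxx ?(ltW D0) ?lexx//; lra.
Qed.

Lemma l2_decomposable (n d : nat) : (1 <= d)%nat ->
  lp_decomposable n d 2 (24 * Num.sqrt (Num.min (ln n%:R) d%:R)).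
Proof.
move=> d1; have [n1|n2] := leqP n 1.
  by apply: (lp_decomposable_small n1); [lra | rewrite mulr_ge0// sqrtr_ge0].
rewrite minElt; case: ifP => _; first exact: l2_decomposition_card.
exact: l2_decomposition_dim.
Qed.

(** For [p <= 4] one Mazur step with [r = p / 2] starts from [l_2]; a larger [p] is halved until it
    falls in this range. *)
Lemma lp_decomposable_ge2 (n d : nat) (p : R) : (1 <= d)%nat -> 2 <= p ->
  lp_decomposable n d p (48 * p ^+ 4 * Num.sqrt (Num.min (ln n%:R) d%:R)).
Proof.
move=> d1; have := @l2_decomposable n d d1.
move: (Num.sqrt _) (sqrtr_ge0 (Num.min (ln n%:R : R) d%:R)) => S S0 l2 p2.
have base (t : R) : 2 <= t -> t <= 4 -> lp_decomposable n d t (48 * t ^+ 4 * S).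
  move=> t2 t4; have r12 : 1 <= t / 2 <= 2 by apply/andP; split; lra.
  have /andP[r1 r2] := r12.
  have -> : lp_decomposable n d t = lp_decomposable n d (t / 2 * 2).
    by congr lp_decomposable; field.
  apply: (mazur_step r1 _ _ _ _ (fun a b => signed_powR_lipschitz a b r12) _ l2);
    [lra | lra | lra | by rewrite mulr_ge0 |].
  (* Crude bounds suffice on [[2, 4]]: [2 * 8 * 2 * 24 = 48 * 16] and [16 <= t ^ 4]. *)
  have e8 : 8 `^ (t / 2 - 1) <= 8 :> R.
    by apply: (@le_trans _ _ (8 `^ 1)); [apply: ler_powR; lra | rewrite powRr1].
  have t16 : 16 <= t ^+ 4.
    have : 4 <= t ^+ 2 by nra.
    have -> : t ^+ 4 = t ^+ 2 * t ^+ 2 by ring.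
    by nra.
  apply: (@le_trans _ _ (2 * (8 * 2 * (24 * S)))).
    by rewrite ler_wpM2l// ler_wpM2r ?mulr_ge0// ler_wpM2r.
  have -> : 2 * (8 * 2 * (24 * S)) = 48 * 16 * S by ring.
  by rewrite ler_wpM2r// ler_wpM2l.
have [M _ hM] := bounded_family_nat (fun _ : unit => p).
have : p <= 2 ^+ M * 4.
  apply: (@le_trans _ _ M%:R); first exact: le_trans (ler_norm _) (hM tt).
  apply: (@le_trans _ _ (2 ^+ M)); first by rewrite -natrX ler_nat ltnW// ltn_expl.
  by rewrite ler_peMr ?exprn_ge0// ler1n.
elim: M p p2 {hM} => [|M IH] p p2; first by rewrite expr0 mul1r; exact: base.
move=> pM; have [|p4] := lerP p 4; first exact: base.
have r12 : 1 <= 2 :> R by lra.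
have -> : lp_decomposable n d p = lp_decomposable n d (2 * (p / 2)).
  by congr lp_decomposable; field.
have half : lp_decomposable n d (p / 2) (48 * (p / 2) ^+ 4 * S).
  by apply: IH; [lra | rewrite exprS in pM; lra].
have h0 : 0 <= 48 * (p / 2) ^+ 4 * S.
  by rewrite mulr_ge0// mulr_ge0// exprn_ge0//; lra.
(* Since [16 * (p / 2) ^ 4 = p ^ 4], the constant [48] is preserved at every doubling. *)
apply: (mazur_step r12 _ _ ler01 h0 (@signed_powR2_lipschitz R) _ half); [lra | lra |].
have -> : 2 - 1 = 1 :> R by ring.
by rewrite powRr1// le_eqVlt; apply/orP; left; apply/eqP; field.
Qed.

Theorem theorem2 :
  exists c : R, 0 < c /\
  forall (p : R) (d n : nat) (x : 'I_n -> 'I_d -> R) (Delta : R),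
    2 <= p -> (1 <= d)%nat -> injective x -> 0 < Delta ->
    exists mu : {ffun {set {set 'I_n}} -> R},
      lipschitz_decomposition (fun i j => lp_dist p (x i) (x j))
        (c * p ^+ 4 * Num.sqrt (Num.min (ln (n%:R : R)) (d%:R : R))) Delta mu.
Proof.
exists 48%:R; split=> // p d n x Delta p2 d1 _ D0.
exact: (@lp_decomposable_ge2 n d p d1 p2 x Delta D0).
Qed.
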